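(* Let $M$ be a left $R$-module which is projective in $\sigma[M]$. The following conditions are equivalent: (a) $Max(M)$ is a normal space. (b) The frame $SPm(M)$ is normal.
   Context: $R$ is an associative ring with identity; modules are unital left $R$-modules. A submodule $N\leq M$ is fully invariant if $f(N)\subseteq N$ for all $f\in\mathrm{End}_R(M)$; $\Lambda^{fi}(M)$ is the lattice of fully invariant submodules of $M$ ordered by inclusion. $\sigma[M]$ is the full subcategory of $R$-Mod of all modules that embed in a quotient of some direct sum $M^{(X)}$. $M$ is $N$-projective if for every epimorphism $\rho\colon N\to X$ and every homomorphism $\alpha\colon M\to X$ there is $\beta\colon M\to N$ with $\rho\beta=\alpha$; $M$ is projective in $\sigma[M]$ if it is $N$-projective for every $N\in\sigma[M]$. $Max(M)$ is the set of maximal submodules of $M$ with the topology whose closed sets are $\{\mathcal{M}\in Max(M)\mid N\leq\mathcal{M}\}$, $N\in\Lambda^{fi}(M)$. For a module $K$, $\mathrm{Ann}_M(K)=\bigcap\{\ker f\mid f\in\mathrm{Hom}_R(M,K)\}$. A proper fully invariant submodule $N$ of $M$ is primitive if $N=\mathrm{Ann}_M(S)$ for some simple module $S$ in $\sigma[M]$; a submodule of $M$ is semiprimitive if it is an intersection of primitive submodules. $SPm(M)=\{M\}\cup\{\text{semiprimitive submodules of }M\}$, ordered by inclusion; when $M$ is projective in $\sigma[M]$ it is a frame in which the meet is intersection. A frame is normal if for all $a,b$ with $a\vee b=1$ there exist $a',b'$ with $a\vee b'=1=a'\vee b$ and $a'\wedge b'=0$ (joins, $0$ and $1$ taken in the frame).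 A topological space is normal if any two disjoint closed subsets are contained respectively in disjoint open subsets (no $T_1$ assumption). *)

(* Defs.v *)
From HB Require Import structures.
From mathcomp Require Import all_boot all_order all_algebra.
From mathcomp Require Import mathcomp_extra boolp classical_sets functions.
From mathcomp Require Import cardinality topology.

Set Implicit Arguments.
Unset Strict Implicit.
Unset Printing Implicit Defensive.

Import Order.TTheory GRing.Theory.

Local Open Scope quotient_scope.
Local Open Scope classical_set_scope.
Local Open Scope ring_scope.

Definition is_submodule (R : pzRingType) (M : lmodType R) (N : set M) : Prop :=
  submod_closed [in N].

Lemma is_submoduleP (R : pzRingType) (M : lmodType R) (N : set M) :
  is_submodule N <->
    N 0 /\ forall (a : R) (x y : M), N x -> N y -> N (a *: x + y).
Proof.
split=> -[N0 NP]; split=> [|a x y]; first by rewrite !inE in N0.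
- by have := NP a x y; rewrite !inE; apply.
- by rewrite !inE.
- by rewrite !inE; exact: NP.
Qed.

(* A submodule, and the quotient by a submodule, as left modules in their own
   right.  [submod_pred] carries the proof [hN] so that the closure instance
   can be inferred from it. *)
Definition submod_pred (R : pzRingType) (M : lmodType R) (N : set M)
  (hN : is_submodule N) : {pred M} := [in N].

HB.instance Definition _ (R : pzRingType) (M : lmodType R) (N : set M)
    (hN : is_submodule N) :=
  GRing.isSubmodClosed.Build R M (submod_pred hN) (GRing.submod_closed_semi hN).

Definition submod (R : pzRingType) (M : lmodType R) (N : set M)
  (hN : is_submodule N) : Type := {x : M | x \in submod_pred hN}.

HB.instance Definition _ (R : pzRingType) (M : lmodType R) (N : set M)
    (hN : is_submodule N) := SubChoice.on (submod hN).
HB.instance Definition _ (R : pzRingType) (M : lmodType R) (N : set M)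
    (hN : is_submodule N) := [SubChoice_isSubLmodule of submod hN by <:].

Lemma submod_elt (R : pzRingType) (M : lmodType R) (N : set M)
  (hN : is_submodule N) (x : M) : N x -> exists y : submod hN, val y = x.
Proof.
move=> Nx; have xN : x \in submod_pred hN by rewrite !inE.
by exists (exist (fun y => y \in submod_pred hN) x xN).
Qed.

Section QuotientModule.
Context {R : pzRingType} {M : lmodType R} {N : set M} (hN : is_submodule N).

Definition quotmod (h : is_submodule N) : Type :=
  Quotient.quot (submod_pred h).
HB.instance Definition _ := GRing.Zmodule.on (quotmod hN).

Definition quotmod_proj (x : M) : quotmod hN :=
  \pi_(Quotient.quot (submod_pred hN)) x.

Lemma quotmod_projP (x y : M) :
  quotmod_proj x = quotmod_proj y <-> N (x - y).
Proof.
have := Quotient.idealrBE (submod_pred hN) x y.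
rewrite unfold_in /= => E; split.
  by move=> /eqP; rewrite -E => /set_mem.
by move=> /mem_set; rewrite E => /eqP.
Qed.

Lemma quotmod_proj_surj (q : quotmod hN) : exists x, quotmod_proj x = q.
Proof.
exists (repr (q : Quotient.quot (submod_pred hN))).
by rewrite /quotmod_proj; exact: reprK.
Qed.

Lemma quotmod_projD (x y : M) :
  quotmod_proj (x + y) = quotmod_proj x + quotmod_proj y.
Proof. exact: (Quotient.pi_add (submod_pred hN) x y). Qed.

Definition quotmod_scale (a : R) (q : quotmod hN) : quotmod hN :=
  quotmod_proj (a *: repr (q : Quotient.quot (submod_pred hN))).

Lemma quotmod_projZ (a : R) (x : M) :
  quotmod_proj (a *: x) = quotmod_scale a (quotmod_proj x).
Proof.
apply/quotmod_projP; rewrite -scalerBr.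
have /quotmod_projP Nx : quotmod_proj x = quotmod_proj
    (repr (quotmod_proj x : Quotient.quot (submod_pred hN))).
  by rewrite /quotmod_proj reprK.
have /is_submoduleP[N0 NP] := hN.
by rewrite -[_ *: _]addr0; apply: NP.
Qed.

Let quotmod_scalerA (a b : R) (q : quotmod hN) :
  quotmod_scale a (quotmod_scale b q) = quotmod_scale (a * b) q.
Proof.
by have [x <-] := quotmod_proj_surj q; rewrite -!quotmod_projZ scalerA.
Qed.

Let quotmod_scale1r : left_id 1 quotmod_scale.
Proof.
by move=> q; have [x <-] := quotmod_proj_surj q; rewrite -quotmod_projZ scale1r.
Qed.

Let quotmod_scalerDr : right_distributive quotmod_scale +%R.
Proof.
move=> a p q.
have [x <-] := quotmod_proj_surj p; have [y <-] := quotmod_proj_surj q.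
by rewrite -quotmod_projD -!quotmod_projZ scalerDr quotmod_projD.
Qed.

Let quotmod_scalerDl (q : quotmod hN) :
  {morph quotmod_scale^~ q : a b / a + b}.
Proof.
move=> a b /=; have [x <-] := quotmod_proj_surj q.
by rewrite -!quotmod_projZ scalerDl quotmod_projD.
Qed.

HB.instance Definition _ := GRing.Zmodule_isLmodule.Build R (quotmod hN)
  quotmod_scalerA quotmod_scale1r quotmod_scalerDr quotmod_scalerDl.

Let quotmod_proj_linear : linear quotmod_proj.
Proof. by move=> a x y; rewrite quotmod_projD quotmod_projZ. Qed.

HB.instance Definition _ :=
  GRing.isLinear.Build R M (quotmod hN) _ quotmod_proj quotmod_proj_linear.

End QuotientModule.

Lemma fin_supp_submodule (R : pzRingType) (M : lmodType R) (X : Type) :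
  is_submodule [set f : X -> M | finite_set [set x | f x != 0]].
Proof.
apply/is_submoduleP; split=> [|a f g /= ff fg].
  rewrite /= (_ : [set x | _] = set0)// predeqE => x; split => //=.
  by rewrite eqxx.
apply: (@sub_finite_set _ _ ([set x | f x != 0] `|` [set x | g x != 0])).
  move=> x /=; have [/= fx0|] := eqVneq (f x) 0; last by left.
  have [/= gx0|] := eqVneq (g x) 0; last by right.
  rewrite [(_ + _) x](_ : _ = a *: f x + g x)//.
  by rewrite fx0 gx0 scaler0 addr0 eqxx.
by rewrite finite_setU.
Qed.

(* The direct sum M^(X): the functions X -> M of finite support. *)
Notation direct_sum X M := (submod (fin_supp_submodule M X)).

(* Membership in sigma[M]; a quotient of M^(X) is presented by a surjection. *)
Definition in_sigma (R : pzRingType) (M N : lmodType R) : Prop :=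
  exists (X : Type) (Q : lmodType R)
    (p : {linear direct_sum X M -> Q}) (i : {linear N -> Q}),
    range p = setT /\ injective i.

Definition relatively_projective (R : pzRingType) (M N : lmodType R) : Prop :=
  forall (X : lmodType R) (rho : {linear N -> X}) (alpha : {linear M -> X}),
    range rho = setT ->
    exists beta : {linear M -> N}, rho \o beta = alpha.

Definition projective_in_sigma (R : pzRingType) (M : lmodType R) : Prop :=
  forall N : lmodType R, in_sigma M N -> relatively_projective M N.

Definition fully_invariant (R : pzRingType) (M : lmodType R) (N : set M) :
    Prop :=
  is_submodule N /\ forall f : {linear M -> M}, f @` N `<=` N.

Definition maximal_submodule (R : pzRingType) (M : lmodType R) (N : set M) :
    Prop :=
  [/\ is_submodule N, N <> setT &
    forall L : set M, is_submodule L -> N `<=` L -> L = N \/ L = setT].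

Definition simple_module (R : pzRingType) (S : lmodType R) : Prop :=
  (exists x : S, x != 0) /\
  forall N : set S, is_submodule N -> N = [set 0] \/ N = setT.

Definition annihilator (R : pzRingType) (M K : lmodType R) : set M :=
  \bigcap_(f in [set: {linear M -> K}]) [set x | f x = 0].
Arguments annihilator {R} M K.

Definition primitive_submodule (R : pzRingType) (M : lmodType R) (N : set M) :
    Prop :=
  [/\ fully_invariant N, N <> setT &
    exists S : lmodType R,
      [/\ simple_module S, in_sigma M S & N = annihilator M S]].

Definition semiprimitive_submodule (R : pzRingType) (M : lmodType R)
    (N : set M) : Prop :=
  exists2 F : set (set M),
    F `<=` @primitive_submodule R M & N = \bigcap_(P in F) P.

(* The space Max(M).  The sets V(N), N fully invariant, are closed under binary
   union only thanks to a primeness property of maximal submodules that uses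
   projectivity in sigma[M], hence the argument [hM]. *)

Lemma submodule_in_sigma (R : pzRingType) (M : lmodType R) (N : set M)
  (hN : is_submodule N) : in_sigma M (submod hN).
Proof.
pose p (f : direct_sum unit M) : M := val f tt.
have plin : linear p by move=> a f g; rewrite /p linearP.
pose pL := GRing.isLinear.Build _ _ _ _ p plin.
pose pM : {linear direct_sum unit M -> M} := HB.pack p pL.
exists unit, M, pM, (val : {linear submod hN -> M}); split; last exact: val_inj.
rewrite -subTset => x _.
have [|f fx] := @submod_elt _ _ _ (fin_supp_submodule M unit) (fun=> x).
  exact: finite_finset.
by exists f => //=; rewrite /p fx.
Qed.

Lemma maximal_submodule_prime (R : pzRingType) (M : lmodType R)
    (hM : projective_in_sigma M) (K N1 N2 : set M) :
  maximal_submodule K -> fully_invariant N1 -> fully_invariant N2 ->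
  N1 `&` N2 `<=` K -> N1 `<=` K \/ N2 `<=` K.
Proof.
move=> [hK KT Kmax] [h1 fi1] [h2 fi2] N12; apply: contrapT.
move=> /not_orP[nN1 nN2]; apply: nN1 => x N1x.
pose rho := (quotmod_proj hK \o (val : submod h2 -> M)) :
  {linear submod h2 -> quotmod hK}.
have /is_submoduleP[K0 KP] := hK; have /is_submoduleP[Z2 P2] := h2.
have rhoT : range rho = setT.
  rewrite -subTset => q _; have [y <-] := quotmod_proj_surj q.
  have hL : is_submodule [set u + v | u in K & v in N2].
    apply/is_submoduleP; split.
      by exists 0 => //; exists 0 => //; rewrite addr0.
    move=> a _ _ [u Ku [v Nv <-]] [u' Ku' [v' Nv' <-]].
    exists (a *: u + u'); first exact: KP.
    exists (a *: v + v'); first exact: P2.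
    by rewrite scalerDr addrACA.
  have [|LK|LT] := Kmax _ hL.
  - by move=> u Ku; exists u => //; exists 0 => //; rewrite addr0.
  - exfalso; apply: nN2 => v Nv; rewrite -LK; exists 0 => //; exists v => //.
    by rewrite add0r.
  - have : [set u + v | u in K & v in N2] y by rewrite LT.
    move=> [u Ku [v Nv uvy]].
    have [w wv] := submod_elt h2 Nv.
    exists w => //=; apply/quotmod_projP.
    rewrite wv -uvy opprD addrCA subrr addr0.
    by rewrite -scaleN1r -[_ *: _]addr0; apply: KP.
have [beta rb] :=
    hM _ (submodule_in_sigma h2) _ rho (quotmod_proj hK) rhoT.
pose g : {linear M -> M} := (val : submod h2 -> M) \o beta.
have gx : K (g x).
  apply: N12; split; first by apply: (fi1 g); exists x.
  by rewrite /g /=; case: (beta x) => z /=; rewrite !inE.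
have /(congr1 (fun h => h x)) /= /esym/quotmod_projP Kx := rb.
by rewrite -(subrK (g x) x) -[_ - _]scale1r; apply: KP.
Qed.

Definition Max (R : pzRingType) (M : lmodType R) (hM : projective_in_sigma M) :
  Type := {K : set M | maximal_submodule K}.

HB.instance Definition _ (R : pzRingType) (M : lmodType R)
  (hM : projective_in_sigma M) := gen_eqMixin (Max hM).
HB.instance Definition _ (R : pzRingType) (M : lmodType R)
  (hM : projective_in_sigma M) := gen_choiceMixin (Max hM).

Section MaxTopology.
Context {R : pzRingType} {M : lmodType R} (hM : projective_in_sigma M).

Definition Max_closed (A : set (Max hM)) : Prop :=
  exists2 N : set M, fully_invariant N &
    A = [set K : Max hM | N `<=` sval K].

Definition Max_open (A : set (Max hM)) : Prop := Max_closed (~` A).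

Let Max_openT : Max_open setT.
Proof.
exists setT.
  by split=> //; apply/is_submoduleP.
rewrite setCT predeqE => -[K [hK KT Kmax]] /=; split=> // TK.
by apply: KT; rewrite -subTset.
Qed.

Let Max_openI : setI_closed Max_open.
Proof.
move=> A B [N1 [h1 fi1] A1] [N2 [h2 fi2] B2]; rewrite /Max_open setCI A1 B2.
have /is_submoduleP[Z1 P1] := h1; have /is_submoduleP[Z2 P2] := h2.
have fi : fully_invariant (N1 `&` N2).
  split.
    apply/is_submoduleP; split=> // a x y [x1 x2] [y1 y2].
    by split; [exact: P1|exact: P2].
  move=> f _ [x [x1 x2] <-].
  by split; [apply: (fi1 f)|apply: (fi2 f)]; exists x.
exists (N1 `&` N2) => //; rewrite predeqE => -[K Kmax] /=; split.
  by move=> [NK x [N1x N2x]|NK x [N1x N2x]]; exact: NK.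
exact: maximal_submodule_prime.
Qed.

Let Max_open_bigcup (I : Type) (f : I -> set (Max hM)) :
  (forall i, Max_open (f i)) -> Max_open (\bigcup_i f i).
Proof.
move=> fop; rewrite /Max_open setC_bigcup.
pose F := [set N | fully_invariant N /\
  exists i, ~` f i = [set K : Max hM | N `<=` sval K]].
pose G := \bigcap_(L in [set L : set M | is_submodule L /\
  forall N, F N -> N `<=` L]) L.
have hG : is_submodule G.
  apply/is_submoduleP; split=> [L [/is_submoduleP[]]//|a x y Gx Gy L LF].
  have [/is_submoduleP[_ LP] _] := LF.
  by apply: LP; [exact: Gx|exact: Gy].
exists G.
  split=> // g _ [x Gx <-] L [/is_submoduleP[L0 LP] LF].
  apply: (Gx [set y | L (g y)]); split.
    apply/is_submoduleP; split; first by rewrite /= linear0.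
    by move=> a y z Ly Lz; rewrite /= linearP; exact: LP.
  move=> N FN y Ny /=; have [[_ fiN] _] := FN.
  by apply: (LF N FN); apply: (fiN g); exists y.
rewrite predeqE => K; split.
- move=> fK x Gx; apply: Gx; split; first by have [] := svalP K.
  move=> N [_ [i fi]]; have : (~` f i) K by apply: fK.
  by rewrite fi.
- move=> GK i _; have [N fiN fi] := fop i; rewrite fi /= => x Nx.
  by apply: GK => L [_ LF]; apply: (LF N) => //; split => //; exists i.
Qed.

HB.instance Definition _ := isOpenTopological.Build (Max hM)
  Max_openT Max_openI Max_open_bigcup.

Lemma Max_closedP (A : set (Max hM)) : closed A <-> Max_closed A.
Proof. by rewrite -openC /open /= /Max_open setCK. Qed.

End MaxTopology.

Lemma normal_spaceE (T : topologicalType) : normal_space T <->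
  forall A B : set T, closed A -> closed B -> A `&` B = set0 ->
  exists U V : set T,
    [/\ open U, open V, A `<=` U, B `<=` V & U `&` V = set0].
Proof.
split=> [nT A B cA cB AB0|nT A cA C /set_nbhsP[D [oD AD DC]]].
  have AnB : set_nbhs A (~` B).
    apply/set_nbhsP; exists (~` B); split=> //; first exact: closed_openC.
    exact/disjoints_subset.
  have [D /set_nbhsP[U [oU AU UD]] DB] := nT _ cA _ AnB.
  exists U, (~` closure D); split=> //.
  - exact/closed_openC/closed_closure.
  - exact/subsetCr.
  - by apply/disjoints_subset; rewrite setCK; exact/(subset_trans UD)/subset_closure.
have AD0 : A `&` ~` D = set0 by apply/disjoints_subset; rewrite setCK.
have [U [V [oU oV AU DV UV0]]] := nT _ _ cA (open_closedC oD) AD0.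
exists U; first by apply/set_nbhsP; exists U; split.
have VC : ~` V `<=` C by apply: (subset_trans _ DC); exact: subsetCl DV.
apply: (subset_trans _ VC); rewrite (closure_id (~` V)).1; last exact: open_closedC.
by apply: closureS; exact/disjoints_subset.
Qed.

Definition SPm (R : pzRingType) (M : lmodType R) : Type :=
  {N : set M | N = setT \/ semiprimitive_submodule N}.

Fact SPm_display : Order.disp_t. Proof. exact: Order.Disp tt tt. Qed.

HB.instance Definition _ (R : pzRingType) (M : lmodType R) :=
  gen_eqMixin (SPm M).
HB.instance Definition _ (R : pzRingType) (M : lmodType R) :=
  gen_choiceMixin (SPm M).

Section SPmLattice.
Context {R : pzRingType} {M : lmodType R}.
Implicit Types A B C : SPm M.

Definition SPm_le A B : bool := `[< sval A `<=` sval B >].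

Lemma SPm_eq A B : sval A = sval B -> A = B.
Proof. by case: A B => A hA [B hB] /= AB; exact: eq_exist. Qed.

Let SPm_le_refl : reflexive SPm_le.
Proof. by move=> A; apply/asboolP. Qed.

Let SPm_le_anti : antisymmetric SPm_le.
Proof.
move=> A B /andP[/asboolP AB /asboolP BA]; apply: SPm_eq.
by apply/seteqP.
Qed.

Let SPm_le_trans : transitive SPm_le.
Proof.
by move=> B A C /asboolP AB /asboolP BC; apply/asboolP; exact: subset_trans BC.
Qed.

HB.instance Definition _ := Order.Le_isPOrder.Build SPm_display (SPm M)
  SPm_le_refl SPm_le_anti SPm_le_trans.

Lemma SPm_inf_subproof (G : set (SPm M)) :
  let N := \bigcap_(A in G) sval A in N = setT \/ semiprimitive_submodule N.
Proof.
move=> N; right.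
exists [set P | primitive_submodule P /\ exists2 A, G A & sval A `<=` P].
  by move=> P [].
apply/seteqP; split=> x Nx.
  by move=> P [_ [A GA AP]]; exact/AP/Nx.
move=> A GA; have [->//|[F Fprim AF]] := svalP A.
rewrite AF => P FP; apply: Nx; split; first exact: Fprim.
by exists A => //; rewrite AF => y; apply.
Qed.

(* The infimum of any family is its intersection (M when the family is empty);
   a supremum is the infimum of the upper bounds. *)
Definition SPm_inf (G : set (SPm M)) : SPm M := exist _ _ (SPm_inf_subproof G).

Definition SPm_meet A B : SPm M := SPm_inf [set A; B].
Definition SPm_join A B : SPm M :=
  SPm_inf [set C | sval A `|` sval B `<=` sval C].
Definition SPm_bottom : SPm M := SPm_inf setT.
Definition SPm_top : SPm M := exist _ setT (or_introl erefl).

Lemma SPm_meetE A B : sval (SPm_meet A B) = sval A `&` sval B.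
Proof. by rewrite /= bigcap_setU !bigcap_set1. Qed.

Let SPm_meetP A B C : (A <= SPm_meet B C)%O = (A <= B)%O && (A <= C)%O.
Proof.
apply/asboolP/andP => [|[/asboolP AB /asboolP AC]]; rewrite SPm_meetE.
  by rewrite subsetI => -[AB AC]; split; exact/asboolP.
by rewrite subsetI.
Qed.

Let SPm_joinP A B C : (SPm_join A B <= C)%O = (A <= C)%O && (B <= C)%O.
Proof.
apply/asboolP/andP => [ABC|[/asboolP AC /asboolP BC]].
  by split; apply/asboolP => x xAB; apply: ABC => D ABD; apply: ABD;
    [left|right].
by move=> x; apply => /=; rewrite subUset.
Qed.

HB.instance Definition _ := Order.POrder_MeetJoin_isLattice.Build SPm_display
  (SPm M) SPm_meetP SPm_joinP.

Let SPm_le0x A : (SPm_bottom <= A)%O.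
Proof. by apply/asboolP => x; apply. Qed.

HB.instance Definition _ := Order.hasBottom.Build SPm_display (SPm M) SPm_le0x.

Let SPm_lex1 A : (A <= SPm_top)%O.
Proof. by apply/asboolP. Qed.

HB.instance Definition _ := Order.hasTop.Build SPm_display (SPm M) SPm_lex1.

End SPmLattice.

(* Normality of a frame only involves its bounded lattice structure. *)
Definition normal_frame (d : Order.disp_t) (L : tbLatticeType d) : Prop :=
  forall a b : L, (a `|` b = \top)%O ->
    exists a' b' : L,
      [/\ (a `|` b' = \top)%O, (a' `|` b = \top)%O & (a' `&` b' = \bot)%O].

(* Main.v *)
Require Import Defs.
From HB Require Import structures.
From mathcomp Require Import all_boot all_order all_algebra.
From mathcomp Require Import boolp classical_sets functions topology.

Set Implicit Arguments.
Unset Strict Implicit.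
Unset Printing Implicit Defensive.

Import Order.TTheory GRing.Theory.

Local Open Scope classical_set_scope.
Local Open Scope ring_scope.

(** Sending an element [A] of [SPm M] to its hull, the set of maximal
    submodules that contain [A], is an order-reversing bijection from [SPm M]
    onto the closed subsets of [Max(M)].  So the frame [SPm M] is the lattice of
    open sets of [Max(M)], and normality of a frame of open sets is normality
    of the space.

    The reason is a description of the primitive submodules.  If [f : M -> S]
    is onto, then projectivity lets every homomorphism from [M] to [S] factor
    as [f \o g] with [g] an endomorphism of [M].  The annihilator of [S] in
    [M] is therefore the largest fully invariant submodule inside the kernel of
    [f], its core ([annihilator_epi]).  A simple module whose annihilator in
    [M] is proper receives a nonzero homomorphism from [M], which is onto and
    has a maximal kernel; so the primitive submodules are exactly the cores of
    the maximal ones ([primitive_submoduleP]).  A fully invariant submodule lies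
    in [K] if and only if it lies in the core of [K]; hence a semiprimitive
    submodule is the intersection of the cores of the members of its hull
    ([SPm_kernelK]), and a closed set is the hull of the intersection of the
    cores of its points ([SPm_hullK]).

    Under this correspondence joins become intersections, and meets become
    unions because maximal submodules are prime with respect to fully invariant
    ones; [1] becomes the empty set and [0] the whole space.  The complements
    of the hulls of [b'] and [a'] are then the open sets that separate the
    hulls of [a] and [b]. *)

(** * Annihilators of epimorphic images *)

Lemma epi_image_in_sigma (R : pzRingType) (M Q : lmodType R)
  (f : {linear M -> Q}) : range f = setT -> in_sigma M Q.
Proof.
move=> fT.
pose p (u : direct_sum unit M) : M := val u tt.
have plin : linear p by move=> a u v; rewrite /p linearP.
pose pL := GRing.isLinear.Build _ _ _ _ p plin.
pose pM : {linear direct_sum unit M -> M} := HB.pack p pL.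
pose fp : {linear direct_sum unit M -> Q} := f \o pM.
exists unit, Q, fp, (idfun : {linear Q -> Q}); split=> //.
rewrite -subTset => q _; have [x _ <-] : range f q by rewrite fT.
have [|u ux] := @submod_elt _ _ _ (fin_supp_submodule M unit) (fun=> x).
  exact: cardinality.finite_finset.
by exists u => //=; rewrite /p ux.
Qed.

(** The core of a submodule [K]: the largest fully invariant submodule
    contained in [K] ([fi_core_fully_invariant], [sub_fi_core]). *)
Definition fi_core (R : pzRingType) (M : lmodType R) (K : set M) : set M :=
  [set x | forall g : {linear M -> M}, K (g x)].

Lemma fi_core_fully_invariant (R : pzRingType) (M : lmodType R) (K : set M) :
  is_submodule K -> fully_invariant (fi_core K).
Proof.
move=> /is_submoduleP[K0 KP]; split.
  apply/is_submoduleP; split=> [g|a x y Kx Ky g]; first by rewrite linear0.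
  by rewrite linearP; exact: KP.
by move=> f _ [x Kx <-] g; exact: (Kx (g \o f)).
Qed.

Lemma sub_fi_core (R : pzRingType) (M : lmodType R) (N K : set M) :
  fully_invariant N -> N `<=` fi_core K <-> N `<=` K.
Proof.
move=> [_ fiN]; split=> [NK x /NK /(_ idfun)//|NK x Nx g].
by apply/NK/fiN; exists x.
Qed.

(** Projectivity enters here: every [h : M -> S] lifts along [f] to an
    endomorphism [g] of [M] with [f \o g = h], so the kernels of the
    homomorphisms to [S] are the preimages of the kernel of [f] under the
    endomorphisms of [M]. *)
Lemma annihilator_epi (R : pzRingType) (M S : lmodType R)
    (hM : projective_in_sigma M) (f : {linear M -> S}) :
  range f = setT -> annihilator M S = fi_core [set x | f x = 0].
Proof.
move=> fT; apply/seteqP; split=> x fx; first by move=> g; exact: (fx (f \o g)).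
move=> h _ /=.
have MM : in_sigma M M.
  by apply: (@epi_image_in_sigma _ _ _ idfun); rewrite image_id.
have [g fg] := hM _ MM _ f h fT.
by rewrite -fg; exact: fx.
Qed.

(** * Primitive submodules are the cores of maximal submodules *)

Lemma simple_epi (R : pzRingType) (M S : lmodType R) (f : {linear M -> S}) x :
  simple_module S -> f x != 0 -> range f = setT.
Proof.
move=> [_ Ssimple] fx0; have [|f0|//] := Ssimple (range f).
  apply/is_submoduleP; split; first by exists 0 => //; rewrite linear0.
  by move=> a _ _ [y _ <-] [z _ <-]; exists (a *: y + z) => //; rewrite linearP.
have : range f (f x) by exists x.
by rewrite f0 /= => fxE; rewrite fxE eqxx in fx0.
Qed.

Lemma maximal_kernel (R : pzRingType) (M S : lmodType R)
    (f : {linear M -> S}) :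
  simple_module S -> range f = setT -> maximal_submodule [set x | f x = 0].
Proof.
move=> [[s s0] Ssimple] fT; split.
- apply/is_submoduleP; split=> [|a x y /= fx fy]; first by rewrite /= linear0.
  by rewrite linearP fx fy scaler0 addr0.
- have [x _ fx] : range f s by rewrite fT.
  by move=> kT; have : setT x by []; rewrite -kT /= fx; exact/eqP.
- move=> L /is_submoduleP[L0 LP] kL.
  have [||fL] := Ssimple (f @` L).
  + apply/is_submoduleP; split; first by exists 0 => //; rewrite linear0.
    move=> a _ _ [y Ly <-] [z Lz <-]; exists (a *: y + z); first exact: LP.
    by rewrite linearP.
  + move=> fL; left; apply/seteqP; split=> // x Lx.
    by have : (f @` L) (f x); [exists x|rewrite fL].
  + right; rewrite -subTset => x _.
    have [y Ly fyx] : (f @` L) (f x) by rewrite fL.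
    rewrite -(subrK y x) -[x - y]scale1r; apply: LP => //.
    by apply: kL; rewrite /= linearB fyx subrr.
Qed.

Lemma simple_quotmod (R : pzRingType) (M : lmodType R) (K : set M)
    (hK : is_submodule K) :
  maximal_submodule K -> simple_module (quotmod hK).
Proof.
move=> [_ KT Kmax]; have /is_submoduleP[K0 KP] := hK.
have proj0 x : quotmod_proj hK x = 0 <-> K x.
  by rewrite -(linear0 (quotmod_proj hK)) quotmod_projP subr0.
split.
  have [x nKx] : exists x, ~ K x.
    apply/existsNP => KA; apply: KT; rewrite -subTset => x _; exact: KA.
  by exists (quotmod_proj hK x); apply/eqP => /proj0.
move=> N /is_submoduleP[N0 NP].
have [||NK|NT] := Kmax (quotmod_proj hK @^-1` N).
- apply/is_submoduleP; split; first by rewrite /= linear0.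
  by move=> a x y /= Nx Ny; rewrite linearP; exact: NP.
- by move=> x /proj0 /= ->.
- left; apply/seteqP; split=> [q|_ ->//].
  have [x <-] := quotmod_proj_surj q => Nx; apply/proj0.
  by rewrite -NK.
- right; rewrite -subTset => q _; have [x <-] := quotmod_proj_surj q.
  by have : (quotmod_proj hK @^-1` N) x by rewrite NT.
Qed.

(** A simple [S] with a proper annihilator in [M] is an image of [M], say by
    [f], and then [K] is the kernel of [f]; conversely a maximal [K] yields the
    simple module [M / K].  In both cases the annihilator is the core of the
    kernel of an epimorphism. *)
Lemma primitive_submoduleP (R : pzRingType) (M : lmodType R)
    (hM : projective_in_sigma M) (N : set M) :
  primitive_submodule N <->
  exists2 K, maximal_submodule K & N = fi_core K.
Proof.
split=> [[_ NT [S [Ssimple _ NS]]]|[K Kmax ->]].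
  have [f [x fx]] : exists (f : {linear M -> S}) x, f x != 0.
    apply: contrapT => nf; apply: NT; rewrite NS -subTset => x _ f _ /=.
    by apply: contrapT => /eqP fx; apply: nf; exists f, x.
  have fT := simple_epi Ssimple fx.
  by exists [set x | f x = 0]; [exact: maximal_kernel|
    rewrite NS (annihilator_epi hM fT)].
have [hK KT _] := Kmax.
have projT : range (quotmod_proj hK) = setT.
  rewrite -subTset => q _.
  by have [x <-] := quotmod_proj_surj q; exists x.
split; first exact: fi_core_fully_invariant.
- move=> coreT; apply: KT; rewrite -subTset -coreT.
  exact/(sub_fi_core _ (fi_core_fully_invariant hK)).
- exists (quotmod hK); split.
  + exact: simple_quotmod.
  + exact: epi_image_in_sigma projT.
  + rewrite (annihilator_epi hM projT); congr fi_core.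
    by apply/seteqP; split=> x /=;
      rewrite -(linear0 (quotmod_proj hK)) quotmod_projP subr0.
Qed.

(** * The correspondence between [SPm M] and the closed sets of [Max(M)] *)

Section HullKernel.
Context {R : pzRingType} {M : lmodType R} (hM : projective_in_sigma M).
Implicit Types (A B : SPm M) (C : set (Max hM)) (K : Max hM).

Lemma SPm_fully_invariant A : fully_invariant (sval A).
Proof.
have [->|[F Fprim ->]] := svalP A; first by split=> //; apply/is_submoduleP.
split; first (apply/is_submoduleP; split=> [P FP|a x y Fx Fy P FP]).
- by have [[/is_submoduleP[]]] := Fprim _ FP.
- have [[/is_submoduleP[_ PP] _ _ _]] := Fprim _ FP.
  by apply: PP; [exact: Fx|exact: Fy].
- move=> f _ [x Fx <-] P FP; have [[_ fiP] _ _] := Fprim _ FP.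
  by apply: (fiP f); exists x => //; exact: Fx.
Qed.

Definition SPm_hull A : set (Max hM) := [set K | sval A `<=` sval K].

Lemma SPm_kernel_subproof C :
  let N := \bigcap_(K in C) fi_core (sval K) in
  N = setT \/ semiprimitive_submodule N.
Proof.
right; exists [set fi_core (sval K) | K in C]; last by rewrite bigcap_image.
move=> _ [K _ <-]; apply/(primitive_submoduleP hM).
by exists (sval K) => //; exact: svalP.
Qed.

Definition SPm_kernel C : SPm M := exist _ _ (SPm_kernel_subproof C).

Lemma closed_SPm_hull A : closed (SPm_hull A).
Proof.
by apply/Max_closedP; exists (sval A) => //; exact: SPm_fully_invariant.
Qed.

(** The hull and kernel maps form an antitone Galois connection, because a
    fully invariant submodule lies in [K] exactly when it lies in its core. *)
Lemma le_SPm_kernel A C : (A <= SPm_kernel C)%O <-> C `<=` SPm_hull A.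
Proof.
have fiA := SPm_fully_invariant A; split=> [/asboolP AC K CK|CA].
  by apply/(sub_fi_core _ fiA) => x Ax; exact: (AC x Ax K CK).
apply/asboolP => x Ax K CK.
by apply: (sub_fi_core _ fiA).2 Ax; exact: CA.
Qed.

Lemma SPm_kernelK A : SPm_kernel (SPm_hull A) = A.
Proof.
apply/le_anti/andP; split; last exact/le_SPm_kernel.
apply/asboolP => x Ax.
have [->//|[F Fprim AF]] := svalP A; rewrite AF => P FP.
have [K Kmax PK] := (primitive_submoduleP hM P).1 (Fprim _ FP).
rewrite PK; apply: (Ax (exist _ K Kmax)).
apply/(sub_fi_core _ (SPm_fully_invariant A)).
by rewrite AF /= -PK => y; apply.
Qed.

Lemma SPm_hullK C : closed C -> SPm_hull (SPm_kernel C) = C.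
Proof.
move=> /Max_closedP[N fiN CN]; apply/seteqP; split; last first.
  exact/le_SPm_kernel.
move=> K CK; rewrite CN /= => x Nx; apply: CK => L CL.
by apply: (sub_fi_core _ fiN).2 Nx; move: CL; rewrite CN.
Qed.

Lemma SPm_hull_inj : injective SPm_hull.
Proof. exact: can_inj SPm_kernelK. Qed.

(** As half of a Galois connection, the hull turns joins into intersections. *)
Lemma SPm_hullU A B : SPm_hull (A `|` B)%O = SPm_hull A `&` SPm_hull B.
Proof.
apply/seteqP; split.
  by rewrite subsetI; split; apply/le_SPm_kernel; rewrite SPm_kernelK ?leUl ?leUr.
apply/le_SPm_kernel; rewrite leUx; apply/andP; split.
  by apply/le_SPm_kernel; exact: subIsetl.
by apply/le_SPm_kernel; exact: subIsetr.
Qed.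

(** The nontrivial inclusion is the primeness of maximal submodules. *)
Lemma SPm_hullI A B : SPm_hull (A `&` B)%O = SPm_hull A `|` SPm_hull B.
Proof.
have AB : sval (A `&` B)%O = sval A `&` sval B := SPm_meetE A B.
rewrite /SPm_hull AB; apply/seteqP; split=> K /=.
  by apply: (maximal_submodule_prime hM (svalP K)); exact: SPm_fully_invariant.
by move=> [AK|BK] x [Ax Bx]; [exact: AK|exact: BK].
Qed.

Lemma SPm_hull1 : SPm_hull \top%O = set0.
Proof.
apply/seteqP; split=> // K TK; have [_ KT _] := svalP K.
by apply: KT; rewrite -subTset; exact: TK.
Qed.

Lemma SPm_hull0 : SPm_hull \bot%O = setT.
Proof. by rewrite -subTset; apply/le_SPm_kernel; exact: le0x. Qed.

Lemma SPm_join_eq1 A B :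
  (A `|` B = \top)%O <-> SPm_hull A `&` SPm_hull B = set0.
Proof.
rewrite -SPm_hullU -SPm_hull1.
by split=> [->|]//; exact: SPm_hull_inj.
Qed.

Lemma SPm_meet_eq0 A B :
  (A `&` B = \bot)%O <-> SPm_hull A `|` SPm_hull B = setT.
Proof.
rewrite -SPm_hullI -SPm_hull0.
by split=> [->|]//; exact: SPm_hull_inj.
Qed.

End HullKernel.

Arguments closed_SPm_hull {R M} hM A.

Theorem corollary3p11 (R : pzRingType) (M : lmodType R)
    (hM : projective_in_sigma M) :
  normal_space (Max hM) <-> normal_frame (SPm M).
Proof.
rewrite normal_spaceE; split=> [nMax a b /(SPm_join_eq1 hM) ab|nSPm A B cA cB AB].
  have [U [V [oU oV aU bV UV]]] :=
    nMax _ _ (closed_SPm_hull hM a) (closed_SPm_hull hM b) ab.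
  exists (SPm_kernel (~` V)), (SPm_kernel (~` U)); split.
  - apply/(SPm_join_eq1 hM); rewrite SPm_hullK; last exact: open_closedC.
    by apply/disjoints_subset; rewrite setCK.
  - apply/(SPm_join_eq1 hM); rewrite SPm_hullK; last exact: open_closedC.
    by rewrite setIC; apply/disjoints_subset; rewrite setCK.
  - apply/(SPm_meet_eq0 hM); rewrite !SPm_hullK; try exact: open_closedC.
    by rewrite -setCI setIC UV setC0.
have [|a' [b' []]] := nSPm (SPm_kernel A) (SPm_kernel B).
  by apply/(SPm_join_eq1 hM); rewrite !SPm_hullK.
move=> /(SPm_join_eq1 hM) Ab' /(SPm_join_eq1 hM) Ba' /(SPm_meet_eq0 hM) a'b'.
rewrite SPm_hullK// in Ab'; rewrite SPm_hullK// in Ba'.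
exists (~` SPm_hull b'), (~` SPm_hull a'); split.
- exact/closed_openC/closed_SPm_hull.
- exact/closed_openC/closed_SPm_hull.
- exact/disjoints_subset.
- by apply/disjoints_subset; rewrite setIC.
- by rewrite -setCU setUC a'b' setCT.
Qed.
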